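(* Let $\gamma$ and $\gamma'$ be two distinct parallel lines in $\mathbb{R}^2$, and let a line orthogonal to both intersect $\gamma$ at $P_1$ and $\gamma'$ at $P_2$. Endow $\gamma$ with the field of transverse lines $L(M)=MP_2$, $M\in\gamma$, and $\gamma'$ with the field of transverse lines $L'(M)=MP_1$, $M\in\gamma'$. Then the resulting projective billiard (the converging mirrors), in which a particle bounces alternately on $\gamma$ and $\gamma'$, is $4$-reflective.
   Context: The plane $\mathbb{R}^2$ is completed by a line at infinity to the real projective plane $\mathbb{RP}^2$, and lines are taken in $\mathbb{RP}^2$. Projective reflection law: let $p$ be a point and let $T\neq L$ be two lines through $p$ ($T$ is the mirror, $L$ the transverse line at $p$). A line $\ell$ through $p$ is reflected into the line $\ell'$ through $p$ if $(\ell,\ell',L,T)$ is harmonic, i.e. has cross-ratio $-1$ (the cross-ratio of four lines through $p$ is the cross-ratio of their intersection points with any fifth line not passing through $p$). Equivalently, $\ell\mapsto \ell'$ is the non-trivial projective involution of the pencil of lines through $p$ fixing $L$ and $T$. Orbit in the converging mirrors: for distinct points $M_0\in\gamma$, $M_1\in\gamma'$, the orbit of $(M_0,M_1)$ is the sequence $(M_k)_{k\in\mathbb{Z}}$ with $M_k\in\gamma$ for $k$ even and $M_k\in\gamma'$ for $k$ odd, such that for each $k$ the line $M_{k-1}M_k$ is reflected into the line $M_kM_{k+1}$ by the projective reflection law at $M_k$ (with mirror $\gamma$ and transverse line $L(M_k)$ if $k$ is even, and mirror $\gamma'$ and transverse line $L'(M_k)$ if $k$ is odd). The orbit is $4$-periodic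 if the lines $M_4M_5$ and $M_0M_1$ coincide. The billiard is $4$-reflective if there is a non-empty open subset $U\times V\subset\gamma\times\gamma'$ such that the orbit of every $(M_0,M_1)\in U\times V$ is $4$-periodic. *)

(* Defs.v *)
From HB Require Import structures.
From mathcomp Require Import all_boot all_order all_algebra.
From mathcomp Require Import boolp classical_sets reals topology normedtype.

Set Implicit Arguments.
Unset Strict Implicit.
Unset Printing Implicit Defensive.

Import Order.TTheory GRing.Theory Num.Theory.
Import numFieldNormedType.Exports.

Local Open Scope classical_set_scope.
Local Open Scope ring_scope.

(* RP^2 is the set of 1-dimensional subspaces of R^3, its lines are the
   2-dimensional subspaces; incidence is inclusion, the line through two
   distinct points p, q is their sum and the common point of two distinct
   lines l, m is (l :&: m)%VS. *)
Notation subspace R := {vspace 'rV[R]_3}.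

Section ProjectivePlane.
Variable R : realType.
Implicit Types (p q l m : subspace R).

Definition is_point p : bool := \dim p == 1%N.
Definition is_line l : bool := \dim l == 2%N.

Definition line_through p q : subspace R := (p + q)%VS.

(* The quotient topology of RP^2 = (R^3 minus 0) / R^*. *)
Definition proj_open (O : set (subspace R)) : Prop :=
  open [set v : 'rV[R]_3 | v != 0 /\ O <[v]>%VS].

Definition open_in_line l (U : set (subspace R)) : Prop :=
  exists2 O, proj_open O & U = [set p | [/\ is_point p, (p <= l)%VS & O p]].

(* Homogeneous coordinates of a point p of a line m, with respect to a basis
   of m; the cross-ratio depends neither on this basis nor on the vector
   representing p. *)
Definition hcoord m (i : 'I_2) p : R :=
  coord [tuple (vbasis m)`_0; (vbasis m)`_1] i (vpick p).

Definition bracket m p q : R :=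
  hcoord m 0 p * hcoord m 1 q - hcoord m 1 p * hcoord m 0 q.

(* As x / 0 = 0, the value is -1 only if each of p1, p2 differs from each of
   p3, p4, so that the cross-ratio is then a genuine one. *)
Definition cross_ratio m p1 p2 p3 p4 : R :=
  (bracket m p1 p3 * bracket m p2 p4) / (bracket m p1 p4 * bracket m p2 p3).

Definition harmonic_lines p l1 l2 l3 l4 : Prop :=
  forall m, is_line m -> ~~ (p <= m)%VS ->
    cross_ratio m (l1 :&: m) (l2 :&: m) (l3 :&: m) (l4 :&: m) = -1.

(* The first alternative is the degenerate case, in which the cross-ratio is
   not defined: the involution of the pencil at p fixes L and T. *)
Definition reflected p (T L l l' : subspace R) : Prop :=
  [/\ is_point p, T != L,
      all is_line [:: T; L; l; l'],
      all (fun x => (p <= x)%VS) [:: T; L; l; l'] &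
      (l = l' /\ (l = L \/ l = T)) \/ harmonic_lines p l l' L T].

Definition is_orbit (g g' : subspace R) (L L' : subspace R -> subspace R)
    (M : int -> subspace R) : Prop :=
  forall k : int,
    let T := if (2 %| k)%Z then g else g' in
    let N := if (2 %| k)%Z then L (M k) else L' (M k) in
    [/\ is_point (M k), (M k <= T)%VS &
        reflected (M k) T N (line_through (M (k - 1)) (M k))
          (line_through (M k) (M (k + 1)))].

Definition four_periodic (M : int -> subspace R) : Prop :=
  line_through (M 4) (M 5) = line_through (M 0) (M 1).

Definition four_reflective (g g' : subspace R)
    (L L' : subspace R -> subspace R) : Prop :=
  exists U V : set (subspace R),
    [/\ open_in_line g U, open_in_line g' V, U !=set0, V !=set0 &
        forall M0 M1, U M0 -> V M1 ->
          (exists M, [/\ is_orbit g g' L L' M, M 0 = M0 & M 1 = M1]) /\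
          (forall M, is_orbit g g' L L' M -> M 0 = M0 -> M 1 = M1 ->
             four_periodic M)].

End ProjectivePlane.

Section AffinePlane.
Variable R : realType.

Record aline := ALine {
  base : 'rV[R]_2;
  dir : 'rV[R]_2;
  dir_neq0 : dir != 0 }.

Definition apoints (g : aline) : set 'rV[R]_2 :=
  [set base g + t *: dir g | t in [set: R]].

Definition parallel (g h : aline) : Prop := <[dir g]>%VS = <[dir h]>%VS.

Definition perpendicular (g h : aline) : Prop := dir g *m (dir h)^T = 0.

(* (x, y) |-> [x : y : 1]; the line at infinity consists of the [x : y : 0]. *)
Definition affine_point (x : 'rV[R]_2) : subspace R :=
  <[(row_mx x 1%:M : 'rV[R]_(2 + 1))]>%VS.

Definition infinite_point (d : 'rV[R]_2) : subspace R :=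
  <[(row_mx d 0 : 'rV[R]_(2 + 1))]>%VS.

Definition completion (g : aline) : subspace R :=
  (affine_point (base g) + infinite_point (dir g))%VS.

End AffinePlane.

(* Main.v *)
(* In homogeneous coordinates put e1 = (P1, 1), e2 = (P2, 1) and f = (d, 0) with
   d the common direction of the mirrors.  Then gamma is the line through e1
   and f, gamma' the line through e2 and f, and the transverse lines pass
   through e2 and e1 respectively.  The reflection at a point M of gamma is
   read off on gamma', where L(M) and gamma cut the points e2 and f: it maps
   e2 + t f to e2 - t f, whatever M is.  Symmetrically a reflection on gamma'
   maps e1 + s f to e1 - s f, so an orbit avoiding e1, e2 and f returns to its
   initial points after four steps.  Only the independence of e1, e2, f
   matters. *)
Require Import Defs.
From HB Require Import structures.
From mathcomp Require Import all_boot all_order all_algebra.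
From mathcomp Require Import boolp classical_sets reals topology normedtype.
From mathcomp Require Import ring.

Set Implicit Arguments.
Unset Strict Implicit.
Unset Printing Implicit Defensive.

Import Order.TTheory GRing.Theory Num.Theory.
Import numFieldNormedType.Exports.

Local Open Scope classical_set_scope.
Local Open Scope ring_scope.

(** * Vector lines and their sums *)

Section VectorSpace.
Variables (K : fieldType) (V : vectType K).
Implicit Types (u v w x y z : V) (U W : {vspace V}).

Definition independent2 x y : Prop :=
  forall a b, a *: x + b *: y = 0 -> a = 0 /\ b = 0.

Definition independent3 x y z : Prop :=
  forall a b c, a *: x + b *: y + c *: z = 0 -> [/\ a = 0, b = 0 & c = 0].

Lemma independent2_neq0 x y : independent2 x y -> y != 0.
Proof.
move=> xy; apply/eqP => y0; have [] := xy 0 1.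
  by rewrite y0 scaler0 scale0r addr0.
by move=> _ /eqP; rewrite oner_eq0.
Qed.

Lemma independent2C x y : independent2 x y -> independent2 y x.
Proof. by move=> xy a b; rewrite addrC => /xy []. Qed.

Lemma line_capv0 x W : x \notin W -> (<[x]> :&: W = 0)%VS.
Proof.
move=> xW; apply/eqP; rewrite -subv0; apply/subvP => y /memv_capP [].
case/vlineP => c ->; have [->|c0] := eqVneq c 0; first by rewrite scale0r memv0.
by move=> cxW; case/negP: xW; rewrite -[x](scalerK c0) memvZ.
Qed.

Lemma line_addv_cap x w W : x \notin W -> w \in W ->
  ((<[x]> + <[w]>) :&: W = <[w]>)%VS.
Proof.
by move=> xW wW; rewrite addvC -vspace_modl -?memvE // line_capv0 // addv0.
Qed.

Lemma dim_addv_lines x y : independent2 x y -> \dim (<[x]> + <[y]>) = 2%N.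
Proof.
move=> xy; rewrite dimv_disjoint_sum ?dim_vline.
  by rewrite (independent2_neq0 xy) (independent2_neq0 (independent2C xy)).
apply: line_capv0; apply/negP => /vlineP [c xcy].
have [] := xy 1 (- c); first by rewrite scale1r scaleNr xcy subrr.
by move=> /eqP; rewrite oner_eq0.
Qed.

(** This serves both to project a point from [x] onto another line and to change the base point of a
    line. *)
Lemma addv_line_shear x y c : (<[x]> + <[c *: x + y]> = <[x]> + <[y]>)%VS.
Proof.
have xS z : x \in (<[x]> + <[z]>)%VS.
  by rewrite (subvP (addvSl _ _)) ?memv_line.
apply/eqP; rewrite eqEsubv; apply/andP; split;
  rewrite subv_add -!memvE; apply/andP.
  by split; rewrite ?xS // memv_add ?memvZ ?memv_line.
split; first exact: xS.
have yE : y = - c *: x + (c *: x + y) by rewrite scaleNr addKr.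
by rewrite [X in X \in _]yE memv_add ?memvZ ?memv_line.
Qed.

Lemma vline_scale a x : a != 0 -> (<[a *: x]> = <[x]>)%VS.
Proof.
move=> a0; apply/eqP; rewrite eqEsubv -!memvE memvZ ?memv_line //=.
by apply/vlineP; exists a^-1; rewrite scalerA mulVf // scale1r.
Qed.

(** [hcoord] uses the representative [vpick], which is controlled only up to this non-zero
    scalar. *)
Lemma vpick_line x : x != 0 -> exists2 a, a != 0 & vpick <[x]> = a *: x.
Proof.
move=> x0; have /vlineP [a xa] := memv_pick <[x]>%VS.
exists a => //; apply/eqP => a0.
by move: xa; rewrite a0 scale0r => /eqP; rewrite vpick0 -dimv_eq0 dim_vline x0.
Qed.

End VectorSpace.

(** * Cross-ratios in coordinates *)

Section CrossRatio.
Variable R : realType.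
Implicit Types (x y z u v w : 'rV[R]_3) (m p q : {vspace 'rV[R]_3}).

(** The counterpart of [hcoord] on vectors instead of points; unlike [hcoord] it is linear. *)
Definition vcoord m (i : 'I_2) v : R :=
  coord [tuple (vbasis m)`_0; (vbasis m)`_1] i v.

Definition vbracket m x y : R :=
  vcoord m 0 x * vcoord m 1 y - vcoord m 1 x * vcoord m 0 y.

Lemma vcoordZD m i a b x y :
  vcoord m i (a *: x + b *: y) = a * vcoord m i x + b * vcoord m i y.
Proof. by rewrite /vcoord linearD !linearZ. Qed.

Lemma vcoordZ m i a x : vcoord m i (a *: x) = a * vcoord m i x.
Proof. by rewrite /vcoord linearZ. Qed.

Lemma vcoord_eq0 m x : is_line m -> x \in m ->
  vcoord m 0 x = 0 -> vcoord m 1 x = 0 -> x = 0.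
Proof.
move=> /eqP m2 xm x0 x1.
(* The two tuples have lengths 2 and [\dim m], so they are compared as sequences. *)
have mE : [tuple (vbasis m)`_0; (vbasis m)`_1] = vbasis m :> seq _.
  case: (vbasis m) => s /= /eqP; rewrite m2.
  by case: s => [|a [|b []]].
have mB : basis_of m [tuple (vbasis m)`_0; (vbasis m)`_1].
  by rewrite mE vbasisP.
rewrite (coord_basis mB xm) big_ord_recl big_ord1.
have -> : lift ord0 ord0 = 1 :> 'I_2 by apply: val_inj.
by move: x0 x1; rewrite /vcoord => -> ->; rewrite !scale0r addr0.
Qed.

(** Were this determinant zero, both coordinates of v_i u - u_i v would vanish for each i.
    Independence would then force v_0 = v_1 = 0, hence v = 0. *)
Lemma vbracket_neq0 m u v : is_line m -> u \in m -> v \in m ->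
  independent2 u v -> vbracket m u v != 0.
Proof.
move=> m2 um vm uv; apply/eqP => uv0.
have comb i : vcoord m i v *: u + (- vcoord m i u) *: v = 0.
  apply: (vcoord_eq0 m2).
  - by rewrite memvD // memvZ.
  - rewrite vcoordZD; case: i => [[|[|//]] lti].
    + by rewrite (_ : Ordinal lti = 0) ?mulNr 1?mulrC ?subrr //; apply: val_inj.
    + rewrite (_ : Ordinal lti = 1); last exact: val_inj.
      by move: uv0; rewrite /vbracket => <-; ring.
  - rewrite vcoordZD; case: i => [[|[|//]] lti].
    + rewrite (_ : Ordinal lti = 0); last exact: val_inj.
      by rewrite -[RHS]oppr0 -uv0 /vbracket; ring.
    + by rewrite (_ : Ordinal lti = 1) ?mulNr 1?mulrC ?subrr //; apply: val_inj.
have [v0 _] := uv _ _ (comb 0); have [v1 _] := uv _ _ (comb 1).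
by have /eqP := independent2_neq0 uv; apply; apply: (vcoord_eq0 m2).
Qed.

(** Each point occurs once above and once below the fraction bar, so the scalars relating [vpick] to
    the given vectors cancel. *)
Lemma cross_ratio_line m x1 x2 x3 x4 :
    x1 != 0 -> x2 != 0 -> x3 != 0 -> x4 != 0 ->
  cross_ratio m <[x1]> <[x2]> <[x3]> <[x4]> =
    (vbracket m x1 x3 * vbracket m x2 x4) /
    (vbracket m x1 x4 * vbracket m x2 x3).
Proof.
move=> /vpick_line [a1 n1 E1] /vpick_line [a2 n2 E2].
move=> /vpick_line [a3 n3 E3] /vpick_line [a4 n4 E4].
have bracketE a b x y p q : vpick p = a *: x -> vpick q = b *: y ->
    bracket m p q = a * b * vbracket m x y.
  rewrite /bracket /hcoord => -> ->; rewrite -!/(vcoord _ _ _) /vbracket.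
  by rewrite !vcoordZ; ring.
rewrite /cross_ratio (bracketE _ _ _ _ _ _ E1 E3) (bracketE _ _ _ _ _ _ E2 E4).
rewrite (bracketE _ _ _ _ _ _ E1 E4) (bracketE _ _ _ _ _ _ E2 E3).
have a0 : a1 * a2 * a3 * a4 != 0 by rewrite !mulf_neq0.
rewrite mulrACA (mulrACA (a1 * a4)) -mulf_div.
rewrite (_ : a1 * a4 * (a2 * a3) = a1 * a3 * (a2 * a4)); last by ring.
by rewrite divff ?mul1r // !mulf_neq0.
Qed.

(** The bracket is bilinear and alternating, so numerator and denominator are both multiples of the
    square of the bracket of [u] and [v], which cancels. When a d = 0, both sides are 0 by the
    convention on division. *)
Lemma cross_ratio_coord m u v (a b c d : R) :
    is_line m -> u \in m -> v \in m -> independent2 u v ->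
    (a != 0) || (b != 0) -> (c != 0) || (d != 0) ->
  cross_ratio m <[a *: u + b *: v]> <[c *: u + d *: v]> <[u]> <[v]>
    = (b * c) / (a * d).
Proof.
move=> m2 um vm uv ab cd.
have uv0 := vbracket_neq0 m2 um vm uv.
have comb_neq0 (x y : R) : (x != 0) || (y != 0) -> x *: u + y *: v != 0.
  by apply: contraTneq => /uv [-> ->]; rewrite eqxx.
rewrite cross_ratio_line ?comb_neq0 //; last 2 first.
- exact: independent2_neq0 (independent2C uv).
- exact: independent2_neq0 uv.
have lbr (x y : R) w : vbracket m (x *: u + y *: v) w
    = x * vbracket m u w + y * vbracket m v w.
  by rewrite /vbracket !vcoordZD; ring.
have vu : vbracket m v u = - vbracket m u v by rewrite /vbracket; ring.
have xx w : vbracket m w w = 0 by rewrite /vbracket; ring.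
rewrite !lbr !xx vu; set D := vbracket m u v in uv0 *.
have -> : (a * 0 + b * - D) * (c * D + d * 0) = b * c * - D ^+ 2 by ring.
have -> : (a * D + b * 0) * (c * 0 + d * - D) = a * d * - D ^+ 2 by ring.
by rewrite -mulf_div divff ?mulr1 // oppr_eq0 expf_neq0.
Qed.

(* Projecting the pencil at x onto m along x reduces the cross-ratio cut on m
   to one computed in the basis of m formed by the projections of y and z. *)
Lemma project_along x y z m : independent3 x y z -> is_line m -> x \notin m ->
  exists a b u v, [/\ u \in m, v \in m, independent2 u v,
                      y = a *: x + u & z = b *: x + v].
Proof.
move=> xyz /eqP m2 xm.
have x0 : x != 0 by apply: contraNneq xm => ->; rewrite mem0v.
have full : (<[x]> + m)%VS = fullv.
  apply/eqP; rewrite eqEdim subvf dimv_disjoint_sum ?line_capv0 //.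
  by rewrite dim_vline x0 m2 dimvf.
have dec w : exists a u, u \in m /\ w = a *: x + u.
  have := memvf w; rewrite -full => /memv_addP [_ /vlineP [a ->]] [u um wE].
  by exists a, u.
have [a [u [um yE]]] := dec y; have [b [v [vm zE]]] := dec z.
exists a, b, u, v; split => // c d cd.
(* If c u + d v = 0, then c y + d z = (c a + d b) x, a relation between [x], [y] and [z]. *)
have [|_ -> ->] // := xyz (- (c * a + d * b)) c d.
by rewrite yE zE !scalerDr !scalerA scaleNr -addrA addrACA -scalerDl addKr.
Qed.

(** Projection along [x] is linear: a line of the pencil has the same coefficients over [y], [z] as
    its trace on [m] has over the projections of [y], [z]. Hence the value is the same for every
    [m]. *)
Lemma harmonic_pencil x y z m (a b c d : R) :
    independent3 x y z -> is_line m -> x \notin m ->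
    (a != 0) || (b != 0) -> (c != 0) || (d != 0) ->
  cross_ratio m ((<[x]> + <[a *: y + b *: z]>) :&: m)
    ((<[x]> + <[c *: y + d *: z]>) :&: m)
    ((<[x]> + <[y]>) :&: m) ((<[x]> + <[z]>) :&: m) = (b * c) / (a * d).
Proof.
move=> xyz m2 xm ab cd.
have [k [l [u [v [um vm uv yE zE]]]]] := project_along xyz m2 xm.
have comb (p q : R) :
    p *: y + q *: z = (p * k + q * l) *: x + (p *: u + q *: v).
  by rewrite yE zE !scalerDr !scalerA addrACA -scalerDl.
have combm (p q : R) : p *: u + q *: v \in m by rewrite memvD ?memvZ.
rewrite !comb yE zE !addv_line_shear !line_addv_cap //.
exact: cross_ratio_coord.
Qed.

End CrossRatio.

(** * The reflection law at a point of a mirror *)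

Section Reflection.
Variable R : realType.
Implicit Types (x y z w : 'rV[R]_3) (p q : {vspace 'rV[R]_3}).

Lemma independent3_shear x y z (s : R) :
  independent3 x y z -> independent3 (x + s *: z) y z.
Proof.
move=> xyz a b c; rewrite scalerDr scalerA addrAC -(addrA (a *: x)) -scalerDl.
by rewrite addrAC => /xyz [-> ->]; rewrite mul0r add0r.
Qed.

Lemma independent3_swap x y z : independent3 x y z -> independent3 y x z.
Proof. by move=> xyz a b c; rewrite (addrC (a *: _)) => /xyz []. Qed.

Lemma independent3_neq0 x y z : independent3 x y z -> x != 0.
Proof.
move=> xyz; apply/eqP => x0; have [] := xyz 1 0 0.
  by rewrite x0 scaler0 !scale0r !addr0.
by move=> /eqP; rewrite oner_eq0.
Qed.

Lemma independent3_comb x y z (a b : R) : independent3 x y z ->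
  (a != 0) || (b != 0) -> independent2 x (a *: y + b *: z).
Proof.
move=> xyz ab c d; rewrite scalerDr !scalerA addrA => /xyz [-> /eqP da /eqP db].
split=> //; apply/eqP; move: da db ab; rewrite !mulf_eq0.
by case: (d == 0) => //= -> ->.
Qed.

(** Modulo [x] the two combinations are proportional, so their determinant vanishes. This tells
    apart lines of the pencil at [x]. *)
Lemma comb_in_line x y z (a b c d : R) : independent3 x y z ->
  a *: y + b *: z \in (<[x]> + <[c *: y + d *: z]>)%VS -> a * d = b * c.
Proof.
move=> xyz /memv_addP [_ /vlineP [k ->]] [_ /vlineP [l ->]] E.
have [|_ /subr0_eq -> /subr0_eq ->] := xyz (- k) (a - l * c) (b - l * d).
  rewrite !scalerBl -!scalerA scaleNr.
  rewrite -addrA addrACA E -opprD -scalerDr addrK.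
  by rewrite addNr.
by ring.
Qed.

(** The cross-ratio given by [harmonic_pencil] is t / (- t) = -1. *)
Lemma reflected_pencil x y z (t : R) : independent3 x y z -> t != 0 ->
  reflected <[x]> (<[x]> + <[z]>) (<[x]> + <[y]>)
    (<[x]> + <[y + t *: z]>) (<[x]> + <[y + (- t) *: z]>).
Proof.
move=> xyz t0.
have E1 a : y + a *: z = 1 *: y + a *: z by rewrite scale1r.
have yE : y = 1 *: y + 0 *: z by rewrite scale0r addr0 scale1r.
have zE : z = 0 *: y + 1 *: z by rewrite scale0r add0r scale1r.
have lineP (a b : R) : (a != 0) || (b != 0) ->
    is_line (<[x]> + <[a *: y + b *: z]>).
  by move=> ab; apply/eqP/dim_addv_lines/independent3_comb.
split.
- by rewrite /is_point dim_vline (independent3_neq0 xyz).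
- apply/eqP => E; have := @comb_in_line x y z 0 1 1 0 xyz.
  rewrite -zE -yE -E => /(_ _)/eqP; rewrite mulr0 mulr1 eq_sym oner_eq0.
  by move=> H; apply/notF/H; rewrite (subvP (addvSr _ _)) ?memv_line.
- have lz : is_line (<[x]> + <[z]>) by rewrite zE lineP ?oner_eq0 ?orbT.
  have ly : is_line (<[x]> + <[y]>) by rewrite yE lineP ?oner_eq0.
  by rewrite /= lz ly !E1 !lineP ?oner_eq0.
- by rewrite /= !addvSl.
- right=> m m2 xm; rewrite !E1 harmonic_pencil ?oner_eq0 //.
  by rewrite mulr1 mul1r invrN mulrN divff.
Qed.

Lemma point_vline p : is_point p -> exists2 w, w != 0 & p = <[w]>%VS.
Proof.
move=> /eqP p1; exists (vpick p); first by rewrite vpick0 -dimv_eq0 p1.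
apply/eqP; rewrite eq_sym eqEdim -memvE memv_pick dim_vline p1.
by rewrite vpick0 -dimv_eq0 p1.
Qed.

Lemma mem_addv_lines y z w : w \in (<[y]> + <[z]>)%VS ->
  exists a b, w = a *: y + b *: z.
Proof.
by move=> /memv_addP [_ /vlineP [a ->]] [_ /vlineP [b ->]] ->; exists a, b.
Qed.

Lemma independent3_notin x y z : independent3 x y z ->
  x \notin (<[y]> + <[z]>)%VS.
Proof.
move=> xyz; apply/negP => /mem_addv_lines [a [b xE]].
have [] := xyz (- 1) a b; first by rewrite scaleN1r -addrA -xE addNr.
by move=> /eqP; rewrite oppr_eq0 oner_eq0.
Qed.

(** Writing q = [c y + d z], the harmonic condition on the transversal through [y] and [z] reads t c
    / d = -1, so d = - t c. *)
Lemma reflected_pencil_unique x y z q (t : R) :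
    independent3 x y z -> t != 0 -> is_point q -> (q <= <[y]> + <[z]>)%VS ->
    reflected <[x]> (<[x]> + <[z]>) (<[x]> + <[y]>)
      (<[x]> + <[y + t *: z]>) (<[x]> + q) ->
  q = <[y + (- t) *: z]>%VS.
Proof.
move=> xyz t0 /point_vline [w w0 ->]; rewrite -memvE.
move=> /mem_addv_lines [c [d wE]].
have cd : (c != 0) || (d != 0).
  apply: contraNT w0; rewrite negb_or !negbK wE => /andP [/eqP -> /eqP ->].
  by rewrite !scale0r addr0.
have yE : y = 1 *: y + 0 *: z by rewrite scale0r addr0 scale1r.
have zE : z = 0 *: y + 1 *: z by rewrite scale0r add0r scale1r.
have tE : y + t *: z = 1 *: y + t *: z by rewrite scale1r.
(* In the degenerate alternative the incoming line would be the transverse line, forcing t = 0, or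
   the mirror, forcing 1 = 0. *)
case=> _ _ _ _ [[_ lLT]|].
  have : 1 *: y + t *: z \in (<[x]> + <[y + t *: z]>)%VS.
    by rewrite -tE (subvP (addvSr _ _)) ?memv_line.
  case: lLT => -> H.
    have := @comb_in_line x y z 1 t 1 0 xyz; rewrite -yE => /(_ H).
    by rewrite mulr0 mulr1 => /esym /eqP; rewrite (negPf t0).
  have := @comb_in_line x y z 1 t 0 1 xyz; rewrite -zE => /(_ H).
  by rewrite mulr0 mulr1 => /eqP; rewrite oner_eq0.
have yz_line : is_line (<[y]> + <[z]>).
  apply/eqP/dim_addv_lines => a b ab.
  by have [|_ -> ->] := xyz 0 a b; first by rewrite scale0r add0r.
have x_yz := independent3_notin xyz.
move=> /(_ _ yz_line x_yz); rewrite wE tE harmonic_pencil ?oner_eq0 //.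
rewrite mul1r => tcd.
(* For d = 0 the quotient would be 0 by convention, not -1. *)
have d0 : d != 0.
  apply/eqP => d0; move: tcd; rewrite d0 invr0 mulr0 => /eqP.
  by rewrite eq_sym oppr_eq0 oner_eq0.
have dE : d = c * - t.
  by rewrite mulrN mulrC -[t * c](divfK d0) tcd mulN1r opprK.
have c0 : c != 0 by apply: contraNneq d0 => c0; rewrite dE c0 mul0r.
by rewrite dE -scalerA -scalerDr vline_scale.
Qed.

Lemma addv_line_shearr x z (s : R) :
  (<[x + s *: z]> + <[z]> = <[x]> + <[z]>)%VS.
Proof. by rewrite addvC addrC addv_line_shear addvC. Qed.

(** Replacing [x] by [x + s *: z] preserves both the mirror and independence, which reduces the
    claim to s = 0. *)
Lemma reflected_line_through x y z (s t : R) : independent3 x y z -> t != 0 ->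
  reflected <[x + s *: z]> (<[x]> + <[z]>)
    (line_through <[x + s *: z]> <[y]>)
    (line_through <[y + t *: z]> <[x + s *: z]>)
    (line_through <[x + s *: z]> <[y + (- t) *: z]>).
Proof.
move=> xyz t0; rewrite -(addv_line_shearr x z s) /line_through.
rewrite (addvC <[y + _]>%VS).
exact/reflected_pencil/t0/independent3_shear.
Qed.

Lemma reflected_line_through_unique x y z q (s t : R) :
    independent3 x y z -> t != 0 -> is_point q -> (q <= <[y]> + <[z]>)%VS ->
    reflected <[x + s *: z]> (<[x]> + <[z]>)
      (line_through <[x + s *: z]> <[y]>)
      (line_through <[y + t *: z]> <[x + s *: z]>)
      (line_through <[x + s *: z]> q) ->
  q = <[y + (- t) *: z]>%VS.
Proof.
move=> xyz t0 q1 qyz; rewrite -(addv_line_shearr x z s) /line_through.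
rewrite (addvC <[y + _]>%VS).
exact/reflected_pencil_unique/qyz/q1/t0/independent3_shear.
Qed.

Lemma is_point_shear x y z (s : R) : independent3 x y z ->
  is_point <[x + s *: z]> /\ (<[x + s *: z]> <= <[x]> + <[z]>)%VS.
Proof.
move=> /(independent3_shear (s := s)) /independent3_neq0 xz0.
rewrite /is_point dim_vline xz0; split=> //.
by rewrite -memvE memv_add ?memvZ ?memv_line.
Qed.

End Reflection.

(** * Orbits in the parameters s and t *)

Section Orbits.
Variables (R : realType) (x y z : 'rV[R]_3).
Hypothesis xyz : independent3 x y z.

Let L M := line_through M <[y]>%VS.
Let L' M := line_through M <[x]>%VS.
Let is_orbit_xyz := is_orbit (<[x]> + <[z]>) (<[y]> + <[z]>) L L'.

(** The successive parameters are forced to be s, t, -s, -t, s, t. Reflections at odd indices use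
    the same lemma with [x] and [y] exchanged. *)
Lemma orbit_period M (s t : R) : s != 0 -> t != 0 -> is_orbit_xyz M ->
  M 0 = <[x + s *: z]>%VS -> M 1 = <[y + t *: z]>%VS -> four_periodic M.
Proof.
move=> s0 t0 orbM M0 M1.
have yxz := independent3_swap xyz.
have [_ _ r1] := orbM 1; have [p2 i2 r2] := orbM 2.
have [p3 i3 r3] := orbM 3; have [p4 i4 r4] := orbM 4.
have [p5 i5 _] := orbM 5.
rewrite /= in r1 i2 r2 i3 r3 i4 r4 i5.
rewrite /four_periodic.
have M2 : M 2 = <[x + (- s) *: z]>%VS.
  by apply: (reflected_line_through_unique (s := t) yxz s0 p2 i2);
    rewrite -M1 -M0.
have M3 : M 3 = <[y + (- t) *: z]>%VS.
  by apply: (reflected_line_through_unique (s := - s) xyz t0 p3 i3);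
    rewrite -M2 -M1.
have M4 : M 4 = M 0.
  rewrite M0 -[s]opprK; move: s0; rewrite -oppr_eq0 => s0.
  by apply: (reflected_line_through_unique (s := - t) yxz s0 p4 i4);
    rewrite -M3 -M2.
have M5 : M 5 = M 1.
  rewrite M1 -[t]opprK; move: t0; rewrite -oppr_eq0 => t0.
  by apply: (reflected_line_through_unique (s := s) xyz t0 p5 i5);
    rewrite -M3 -M0 -?M4.
by rewrite M4 M5.
Qed.

Lemma orbit_exists (s t : R) : s != 0 -> t != 0 ->
  exists M, [/\ is_orbit_xyz M, M 0 = <[x + s *: z]>%VS &
    M 1 = <[y + t *: z]>%VS].
Proof.
move=> s0 t0; have yxz := independent3_swap xyz.
(* The signs follow the pattern +, +, -, - from k = 0 on; the quotient rounds down, so the pattern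
   continues to negative k. *)
pose eps (k : int) : R := (-1) ^ (k %/ 2)%Z.
pose M (k : int) := if (2 %| k)%Z then <[x + (eps k * s) *: z]>%VS
  else <[y + (eps k * t) *: z]>%VS.
have odd2 j : (2 %| j * 2 + 1)%Z = false by rewrite rpredDl ?dvdz_mull.
have even2 j : (2 %| j * 2)%Z by rewrite dvdz_mull.
have Meven (j : int) : M (j * 2) = <[x + ((-1) ^ j * s) *: z]>%VS.
  by rewrite /M /eps even2 mulzK.
have Modd (j : int) : M (j * 2 + 1) = <[y + ((-1) ^ j * t) *: z]>%VS.
  by rewrite /M /eps odd2 divzMDl // addr0.
have sgnD (j : int) : (-1) ^ (j + 1) = - (-1) ^ j :> R.
  by rewrite expfzDr ?oppr_eq0 ?oner_eq0 // expr1z mulrN1.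
have sgn0 (j : int) (a : R) : a != 0 -> (-1) ^ j * a != 0.
  by move=> a0; rewrite mulf_neq0 // expfz_neq0 // oppr_eq0 oner_eq0.
exists M; split; first 1 last.
- by rewrite (Meven 0) expr0z mul1r.
- by rewrite (Modd 0) expr0z mul1r.
move=> k T N; rewrite {}/T {}/N.
have [j [->|->]] : exists j, k = j * 2 \/ k = j * 2 + 1.
  exists (k %/ 2)%Z; rewrite {1 3}(divz_eq k 2).
  have := modz_ge0 k (isT : 2 != 0 :> int).
  have := ltz_pmod k (isT : 0 < 2 :> int).
  by case: (k %% 2)%Z => // [[|[|n]]] // _ _; [left; rewrite addr0|right].
- have [Mp Mi] := is_point_shear ((-1) ^ j * s) xyz.
  rewrite even2 Meven; split=> //.
  have -> : j * 2 - 1 = (j - 1) * 2 + 1 by ring.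
  (* The two odd neighbours of an even index have opposite signs, as the reflection requires. *)
  have tE : (-1) ^ j * t = - ((-1) ^ (j - 1) * t) by rewrite -mulNr -sgnD subrK.
  rewrite !Modd tE.
  exact/reflected_line_through/sgn0.
- have [Mp Mi] := is_point_shear ((-1) ^ j * t) yxz.
  rewrite odd2 Modd; split=> //.
  have -> : j * 2 + 1 + 1 = (j + 1) * 2 by ring.
  rewrite addrK !Meven sgnD mulNr.
  exact/reflected_line_through/sgn0.
Qed.

End Orbits.

(** * Open sets of initial points *)

Section OpenSets.
Variable R : realType.
Implicit Types (x y z v : 'rV[R]_3).

Lemma mulmx_coord_continuous (m n : nat) (C : 'M[R]_(m, n)) i :
  continuous (fun v : 'rV[R]_m => (v *m C) 0 i).
Proof.
under eq_fun do rewrite mxE.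
apply: continuous_big => [|k _]; first exact: add_continuous.
move=> v; exact: (cvgM (@coord_continuous R 1 m 0 k v) (cvg_cst (C k i))).
Qed.

(** [C] inverts the matrix with rows [x], [y], [z], so [v *m C] lists the coordinates of [v] in this
    basis and depends continuously on [v]. *)
Lemma dual_basis x y z : independent3 x y z -> exists C : 'M[R]_3,
  [/\ x *m C = delta_mx 0 0, y *m C = delta_mx 0 1 & z *m C = delta_mx 0 2].
Proof.
move=> xyz; pose B := \matrix_(i < 3) [tuple x; y; z]`_i.
have Bu : B \in unitmx.
  rewrite -row_free_unit; apply: inj_row_free => v.
  rewrite mulmx_sum_row !big_ord_recl big_ord0 addr0 !rowK /= addrA.
  move=> /xyz [v0 v1 v2]; apply/rowP => i; rewrite mxE.
  suff [->|->|->] : [\/ i = ord0, i = lift ord0 ord0 |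
    i = lift ord0 (lift ord0 ord0)] by [].
  by case: i => [[|[|[|//]]] ?]; [apply: Or31|apply: Or32|apply: Or33];
    exact: val_inj.
exists (invmx B).
have rowE (i : 'I_3) : [tuple x; y; z]`_i *m invmx B = delta_mx 0 i.
  have <- : row i B = [tuple x; y; z]`_i by rewrite rowK.
  by rewrite -row_mul mulmxV // row1.
by split; rewrite -rowE.
Qed.

(** The set [U] is the line with the points [x] and [z] removed. *)
Lemma generic_points x y z : independent3 x y z ->
  exists U, [/\ open_in_line (<[x]> + <[z]>) U, U !=set0 &
    forall p, U p -> exists2 s, s != 0 & p = <[x + s *: z]>%VS].
Proof.
move=> xyz; have [C [xC yC zC]] := dual_basis xyz.
(* The product of the [x] and [z] coordinates is homogeneous of degree two, so its non-vanishing is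
   a property of projective points. *)
pose F v := (v *m C) 0 0 * (v *m C) 0 2.
have FZ a v : F (a *: v) = a ^+ 2 * F v.
  by rewrite /F -scalemxAl !mxE; ring.
have Fcomb a b : F (a *: x + b *: z) = a * b.
  by rewrite /F mulmxDl -!scalemxAl xC zC !mxE /=; ring.
have F_line v : v != 0 -> (F (vpick <[v]>%VS) != 0) = (F v != 0).
  by move=> /vpick_line [a a0 ->]; rewrite FZ mulf_eq0 expf_eq0 (negPf a0).
pose O : set {vspace 'rV[R]_3} := [set p | F (vpick p) != 0].
exists [set p | [/\ is_point p, (p <= <[x]> + <[z]>)%VS & O p]]; split.
- exists O => //; rewrite /proj_open.
  suff F_open : open [set v : 'rV[R]_3 | v != 0 /\ O <[v]>%VS] by exact: F_open.
  suff -> : [set v : 'rV[R]_3 | v != 0 /\ O <[v]>%VS] =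
      F @^-1` [set t | t != 0].
    apply: open_comp; last exact: open_neq.
    move=> v _; exact: (cvgM (@mulmx_coord_continuous 3 3 C 0 v)
      (@mulmx_coord_continuous 3 3 C 2 v)).
  apply/seteqP; split => v /=; first by case=> v0; rewrite /O /= F_line.
  move=> Fv; have v0 : v != 0.
    by apply: contraNneq Fv => ->; rewrite /F mul0mx mxE mul0r.
  by split=> //; rewrite /O /= F_line.
- exists <[x + 1 *: z]>%VS; have [p1 pxz] := is_point_shear 1 xyz.
  split=> //; rewrite /O /= F_line.
    by rewrite -[x]scale1r Fcomb mulr1 oner_eq0.
  by apply: contraTneq p1 => ->; rewrite /is_point dim_vline eqxx.
- move=> p [/point_vline [w w0 ->]]; rewrite -memvE /O /= F_line //.
  move=> /mem_addv_lines [a [b ->]]; rewrite Fcomb mulf_eq0 negb_or.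
  move=> /andP [a0 b0]; exists (b / a); first by rewrite mulf_neq0 ?invr_eq0.
  by rewrite -[RHS](vline_scale _ a0) scalerDr scalerA mulrC divfK.
Qed.

End OpenSets.

Lemma four_reflective_basis (R : realType) (x y z : 'rV[R]_3) :
  independent3 x y z ->
  four_reflective (<[x]> + <[z]>) (<[y]> + <[z]>)
    (fun M => line_through M <[y]>) (fun M => line_through M <[x]>).
Proof.
move=> xyz; have [U [oU U0 Us]] := generic_points xyz.
have [V [oV V0 Vt]] := generic_points (independent3_swap xyz).
exists U, V; split=> // M0 M1 /Us [s s0 ->] /Vt [t t0 ->].
by split=> [|M]; [exact: orbit_exists|exact: orbit_period].
Qed.

(** * From the Euclidean configuration to a basis *)

Section AffineLines.
Variable R : realType.
Implicit Types (g h : aline R) (P : 'rV[R]_2).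

(** Moving the base point along the line is a shear by the vector at infinity. *)
Lemma completion_base g P : apoints g P ->
  completion g = (affine_point P + infinite_point (dir g))%VS.
Proof.
case=> t _ <-; rewrite /completion /affine_point /infinite_point.
rewrite addvC [RHS]addvC.
rewrite -(addv_line_shear (row_mx (dir g) 0 : 'rV[R]_(2 + 1)) _ t).
by rewrite scale_row_mx add_row_mx scaler0 add0r (addrC (t *: _)).
Qed.

Lemma parallel_apoints g h P :
  parallel g h -> apoints g P -> apoints h P -> apoints g = apoints h.
Proof.
have sub g1 g2 : parallel g1 g2 -> apoints g1 P -> apoints g2 P ->
    apoints g1 `<=` apoints g2.
  move=> gh [s _ sP] [t _ tP] _ [r _ <-].
  have /vlineP [k kE] : dir g1 \in <[dir g2]>%VS by rewrite -gh memv_line.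
  (* The point with parameter [r] on [g1] is P + (r - s) [dir g1], where P has parameter [t] on [g2]
     and [dir g1] is [k] times [dir g2]. *)
  exists (t + (r - s) * k) => //.
  by rewrite scalerDl addrA tP -sP -addrA -scalerA -kE -scalerDl
    (addrC s) subrK.
by move=> gh gP hP; apply/seteqP; split; apply: sub.
Qed.

Lemma row_mul_trmx_eq0 (u : 'rV[R]_2) : u *m u^T = 0 -> u = 0.
Proof.
move=> /matrixP /(_ 0 0); rewrite !mxE => /eqP.
rewrite psumr_eq0 => [/allP uu|i _]; last by rewrite mxE -expr2 sqr_ge0.
apply/rowP => i; rewrite mxE; apply/eqP.
by have := uu i (mem_index_enum i); rewrite mxE mulf_eq0 orbb.
Qed.

(** The last homogeneous coordinate gives b = - a, so a P + b Q is a multiple of [dir h]. The scalar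
    product with [dir g] then kills c, and a (P - Q) = 0 remains. *)
Lemma independent3_affine (g h : aline R) P Q : perpendicular h g ->
  apoints h P -> apoints h Q -> P != Q ->
  independent3 (row_mx P 1%:M : 'rV[R]_(2 + 1)) (row_mx Q 1%:M)
    (row_mx (dir g) 0).
Proof.
move=> hg [s _ sP] [t _ tQ] PQ a b c.
rewrite !scale_row_mx !add_row_mx scaler0 addr0 -scalerDl -row_mx0.
move=> /eq_row_mx [abPQ /matrixP /(_ 0 0)]; rewrite !mxE mulr1 => /eqP.
rewrite addrC addr_eq0 => /eqP bE.
have PQE : a *: P + b *: Q = (a * (s - t)) *: dir h.
  rewrite bE -sP -tQ scaleNr -scalerBr opprD addrACA subrr add0r -scalerBl.
  by rewrite scalerA.
have c0 : c = 0.
  move: (abPQ) => /(congr1 (mulmx^~ (dir g)^T)).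
  rewrite PQE mulmxDl -!scalemxAl hg scaler0 add0r mul0mx => /eqP.
  rewrite scaler_eq0 => /orP [/eqP //|/eqP /row_mul_trmx_eq0 g0].
  by have := dir_neq0 g; rewrite g0 eqxx.
move: abPQ; rewrite c0 scale0r addr0 bE scaleNr -scalerBr => /eqP.
rewrite scaler_eq0 subr_eq0 (negPf PQ) orbF => /eqP ->.
by rewrite oppr0.
Qed.

End AffineLines.

Theorem proposition3p1 (R : realType) (g g' h : aline R) (P1 P2 : 'rV[R]_2)
    (gg'_distinct : apoints g <> apoints g')
    (gg'_parallel : parallel g g')
    (hg_perp : perpendicular h g)
    (hg'_perp : perpendicular h g')
    (P1_inter : apoints h `&` apoints g = [set P1])
    (P2_inter : apoints h `&` apoints g' = [set P2]) :
  four_reflective (completion g) (completion g')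
    (fun M => line_through M (affine_point P2))
    (fun M => line_through M (affine_point P1)).
Proof.

have hP1 : (apoints h `&` apoints g) P1 by rewrite P1_inter.
have hP2 : (apoints h `&` apoints g') P2 by rewrite P2_inter.
case: hP1 hP2 => hP1 gP1 [hP2 g'P2].
(* Parallel lines with a common point would coincide. *)
have P12 : P1 != P2.
  apply/eqP => P12; apply: gg'_distinct; rewrite -P12 in g'P2.
  exact: parallel_apoints gP1 g'P2.
rewrite (completion_base gP1) (completion_base g'P2).
(* Parallel mirrors meet at infinity; this common point is the third basis point. *)
have -> : infinite_point (dir g') = infinite_point (dir g).
  have /vlineP [k kE] : dir g' \in <[dir g]>%VS
    by rewrite gg'_parallel memv_line.
  have k0 : k != 0.
    by have := dir_neq0 g'; rewrite kE;
      apply: contraNneq => ->; rewrite scale0r.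
  rewrite /infinite_point kE -(vline_scale (row_mx (dir g) 0) k0).
  by rewrite scale_row_mx scaler0.
exact/four_reflective_basis/(independent3_affine hg_perp).
Qed.
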